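(* Let $a,b$ be positive integers with $a+2<2b+1<2a-1$. Let $x_F$ be the Fibonacci word, the fixed point of $0\mapsto 01$, $1\mapsto 0$, let $\mathcal{L}_F$ be the set of nonempty finite factors of $x_F$, and let $S:\mathcal{L}_F\to\mathbb{N}$ be given by $S(w)=a|w|_0+b|w|_1$. Let $C$ be the increasing enumeration of $\mathbb{N}\setminus S(\mathcal{L}_F)$ and $\Delta C=(C(n+1)-C(n))_{n\ge1}$. Let $x_H$ be the fixed point starting with $a$ of the morphism $h$ on the two-letter alphabet $\{a,b\}$ given by $h(a)=aab$, $h(b)=ab$. Then $\Delta C=\delta(x_H)$, where $\delta$ is the morphism given by $\delta(a)=1^{b-2}\,2\,1^{a-b-2}\,2$ and $\delta(b)=1^{2b-a-2}\,2\,1^{a-b-2}\,2$.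
   Context: $\mathbb{N}=\{1,2,3,\dots\}$. $|w|_0$ and $|w|_1$ denote the numbers of occurrences of $0$ and $1$ in $w$; the map $S$ is exactly a homomorphism of the Fibonacci language into $\mathbb{N}$ (i.e. $S(vw)=S(v)+S(w)$) with $S(0)=a$, $S(1)=b$. Here $a,b$ are used both as integers and as abstract letters. $\delta(x_H)$ is the concatenation of the images of the letters of $x_H$, and $1^m$ denotes $m$ copies of $1$. *)

(* Defs.v *)
From mathcomp Require Import all_boot.

Set Implicit Arguments.
Unset Strict Implicit.
Unset Printing Implicit Defensive.

(* Infinite words over T are functions nat -> T, indexed from 0: the n-th     *)
(* letter in 1-based numbering is x n.-1.                                     *)

(* A morphism of free monoids is given by the images of the letters.          *)
Definition morph (A B : Type) (phi : A -> seq B) (w : seq A) : seq B :=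
  flatten (map phi w).

(* y is the infinite word phi(x). The second clause says that phi(x) is       *)
(* indeed infinite, so that y is determined by x, even if phi is erasing.     *)
Definition is_image (A B : Type) (phi : A -> seq B)
    (x : nat -> A) (y : nat -> B) : Prop :=
  (forall n, let v := morph phi (mkseq x n) in v = mkseq y (size v)) /\
  (forall N, exists n, N <= size (morph phi (mkseq x n))).

Definition is_fixed_point (A : Type) (phi : A -> seq A) (x : nat -> A) : Prop :=
  is_image phi x x.

(* The letters 0 and 1 are false and true.                                    *)
Definition fibonacci (c : bool) : seq bool :=
  if c then [:: false] else [:: false; true].

Definition is_nonempty_factor (A : Type) (x : nat -> A) (w : seq A) : Prop :=
  0 < size w /\ exists i, w = mkseq (fun j => x (i + j)) (size w).

Definition S_F (a b : nat) (w : seq bool) : nat :=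
  a * count_mem false w + b * count_mem true w.

Definition image_SF (a b : nat) (x : nat -> bool) (k : nat) : Prop :=
  exists w, is_nonempty_factor x w /\ S_F a b w = k.

(* The complement is taken in {1, 2, 3, ...}.                                 *)
Definition complement_SF (a b : nat) (x : nat -> bool) (k : nat) : Prop :=
  0 < k /\ ~ image_SF a b x k.

(* C 0 < C 1 < ... are exactly the elements of P.                             *)
Definition is_increasing_enumeration (P : nat -> Prop) (C : nat -> nat) : Prop :=
  (forall n, C n < C n.+1) /\ (forall k, P k <-> exists n, C n = k).

Definition difference (C : nat -> nat) (n : nat) : nat := C n.+1 - C n.

(* The abstract letters a and b, as opposed to the integers.                  *)
Inductive letter : Type := La | Lb.

Definition h (c : letter) : seq letter :=
  match c with
  | La => [:: La; La; Lb]
  | Lb => [:: La; Lb]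
  end.

(* No exponent is truncated when a + 2 < 2b + 1 < 2a - 1.                     *)
Definition delta (a b : nat) (c : letter) : seq nat :=
  match c with
  | La => nseq (b - 2) 1 ++ [:: 2] ++ nseq (a - b - 2) 1 ++ [:: 2]
  | Lb => nseq (2 * b - a - 2) 1 ++ [:: 2] ++ nseq (a - b - 2) 1 ++ [:: 2]
  end.

Lemma morph_cat (A B : Type) (phi : A -> seq B) u v :
  morph phi (u ++ v) = morph phi u ++ morph phi v.
Proof. by rewrite /morph map_cat flatten_cat. Qed.

Lemma size_morph (A B : Type) (phi : A -> seq B) :
  (forall d, 0 < size (phi d)) -> forall w, size w <= size (morph phi w).
Proof.
move=> phi_gt0; elim=> [|d w IHw] //.
by rewrite /morph /= size_cat -add1n leq_add.
Qed.

Lemma exists_fixed_point (A : Type) (phi : A -> seq A) (c : A) (w : seq A) :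
  (forall d, 0 < size (phi d)) -> phi c = c :: w -> 0 < size w ->
  exists x, x 0 = c /\ is_fixed_point phi x.
Proof.
move=> phi_gt0 phi_c w_gt0; pose u n := iter n (morph phi) [:: c].
have uS n : exists2 v, u n.+1 = u n ++ v & 0 < size v.
  elim: n => [|n [v uE v_gt0]].
    by exists w; rewrite // /u /= /morph /= cats0 phi_c.
  exists (morph phi v); last exact: leq_trans v_gt0 (size_morph phi_gt0 v).
  by rewrite -morph_cat -uE.
have usz n : n < size (u n).
  elim: n => [|n IHn] //; have [v -> v_gt0] := uS n.
  by rewrite size_cat -addn1 leq_add.
have u_nth m n i : i < size (u n) -> nth c (u (n + m)) i = nth c (u n) i.
  elim: m => [|m IHm] lti; first by rewrite addn0.
  have lt' : i < size (u (n + m)).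
    elim: m {IHm} => [|m IH]; first by rewrite addn0.
    have [v uE _] := uS (n + m).
    by rewrite addnS uE size_cat (leq_trans IH) ?leq_addr.
  by have [v uE _] := uS (n + m); rewrite addnS uE nth_cat lt' IHm.
pose x n := nth c (u n) n.
have xE n i : i < size (u n) -> nth c (u n) i = x i.
  move=> lti; rewrite /x -(u_nth n i i (usz i)) addnC.
  by rewrite u_nth.
have u_pref n : u n = mkseq x (size (u n)).
  apply: (@eq_from_nth _ c) => [|i lti]; first by rewrite size_mkseq.
  by rewrite nth_mkseq // xE.
have take_mk k m : k <= m -> take k (mkseq x m) = mkseq x k.
  by move=> le_km; rewrite /mkseq -map_take take_iota (minn_idPl le_km).
exists x; split=> //; split=> [n v|N]; last first.
  by exists N; rewrite -{1}(size_mkseq x N) size_morph.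
have uE : u n = mkseq x n ++ drop n (u n).
  rewrite -{1}(cat_take_drop n (u n)); congr (_ ++ _).
  by rewrite {1}u_pref take_mk // ltnW.
have vE : u n.+1 = v ++ morph phi (drop n (u n)).
  by rewrite /v -morph_cat -uE.
have -> : v = take (size v) (u n.+1) by rewrite vE take_size_cat.
by rewrite {1}u_pref take_mk ?size_takel // vE size_cat leq_addr.
Qed.

Lemma exists_fibonacci_word : exists x, is_fixed_point fibonacci x.
Proof.
have fib_gt0 c : 0 < size (fibonacci c) by case: c.
have [x [_ hx]] := @exists_fixed_point _ _ false [:: true] fib_gt0 erefl isT.
by exists x.
Qed.

Lemma exists_h_word : exists x, x 0 = La /\ is_fixed_point h x.
Proof. by apply: (@exists_fixed_point _ h La [:: La; Lb]) => //; case. Qed.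

(* Main.v *)
(* Put y = 0 x_F. It is fixed by the conjugate 0 -> 001, 1 -> 01 of the square
   of the Fibonacci morphism, hence it is x_H with a, b read as 0, 1. Let E(n)
   be the number of 1s in its prefix of length n. Each block of that morphism
   ends with its only 1, which gives the adjunction m <= E(n) iff 3m - E(m) <=
   n and, by induction, E(i) + E(n) <= E(i+n) <= E(i) + E(n) + 1. So a factor
   of length n of x_F has E(n) or E(n) + 1 ones; both occur, since every
   prefix of x_F can be extended to the left by 0 and by 1. Therefore S(L_F)
   consists of the numbers X(n) and X(n) - (a-b) for n >= 1, where X(n) = a (n
   - E(n)) + b E(n), and the part of the complement between X(n) and X(n+1)
   yields the image under delta of the letter of x_H of index n. *)
Require Import Defs.
From mathcomp Require Import all_boot.
From mathcomp Require Import zify.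

Set Implicit Arguments.
Unset Strict Implicit.
Unset Printing Implicit Defensive.

(** * Prefixes and factors of infinite words; uniqueness of fixed points *)

Lemma mkseq_cat (T : Type) (f : nat -> T) m n :
  mkseq f (m + n) = mkseq f m ++ mkseq (fun j => f (m + j)) n.
Proof.
rewrite /mkseq iotaD map_cat; congr (_ ++ _).
by rewrite add0n -[m in iota m n]addn0 iotaDl -map_comp.
Qed.

Lemma mkseq_prefix (T : Type) (f : nat -> T) n s t :
  mkseq f n = s ++ t -> s = mkseq f (size s).
Proof.
move=> e; have en : n = size s + size t by rewrite -size_cat -e size_mkseq.
move: e; rewrite en mkseq_cat => /(congr1 (take (size s))).
by rewrite take_size_cat ?size_mkseq // take_size_cat.
Qed.

Lemma mkseq_factor (T : Type) (f : nat -> T) i n s t r :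
  mkseq (fun j => f (i + j)) n = s ++ t ++ r ->
  t = mkseq (fun j => f (i + size s + j)) (size t).
Proof.
rewrite catA => /mkseq_prefix; rewrite size_cat mkseq_cat => e.
have := congr1 (drop (size s)) e.
rewrite drop_size_cat // drop_size_cat ?size_mkseq // => ->.
by rewrite size_mkseq; apply: eq_mkseq => j; rewrite addnA.
Qed.

Lemma image_take (A B : Type) (phi : A -> seq B) x y n k :
  is_image phi x y -> k <= size (morph phi (mkseq x n)) ->
  mkseq y k = take k (morph phi (mkseq x n)).
Proof.
case=> /(_ n) /= -> _; rewrite size_mkseq => /subnKC <-.
by rewrite mkseq_cat take_size_cat ?size_mkseq.
Qed.

(** Images are nonempty and the first one has at least two letters, so the image of a prefix of
    length [n + 1] determines the prefix of length [n + 2]. *)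
Lemma fixed_point_unique (A : Type) (phi : A -> seq A) (x y : nat -> A) :
  (forall d, 0 < size (phi d)) -> 1 < size (phi (x 0)) -> x 0 = y 0 ->
  is_fixed_point phi x -> is_fixed_point phi y -> x =1 y.
Proof.
move=> phi_gt0 phi_gt1 xy0 hx hy.
have pre n : mkseq x n.+1 = mkseq y n.+1.
  elim: n => [|n IHn]; first by rewrite /mkseq /= xy0.
  have lt_v : n.+2 <= size (morph phi (mkseq x n.+1)).
    rewrite /mkseq /= /morph /= size_cat.
    apply: leq_trans (_ : 2 + n <= _) => //; apply: leq_add => //.
    by apply: leq_trans (size_morph phi_gt0 _); rewrite size_map size_iota.
  by rewrite (image_take hx lt_v) (image_take hy (n := n.+1)) -IHn.
by move=> n; have := pre n; rewrite !mkseqS => /rcons_inj[].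
Qed.

(** * The word [0 x_F] and its identification with [x_H] *)

Lemma fibonacci_gt0 c : 0 < size (fibonacci c).
Proof. by case: c. Qed.

Lemma fibonacci_word0 x : is_fixed_point fibonacci x -> x 0 = false.
Proof.
by case=> /(_ 1) /= + _; rewrite /morph /mkseq /=; case e: (x 0); rewrite //= e.
Qed.

Definition shift_fib (x : nat -> bool) (n : nat) : bool :=
  if n is m.+1 then x m else false.

Definition letter_of (c : bool) : letter := if c then Lb else La.

(* The morphism [h] read on [false] and [true]. *)
Definition hb (c : bool) : seq bool :=
  if c then [:: false; true] else [:: false; false; true].

(** With [phi] the Fibonacci morphism, [phi(phi(c)) 01 = 01 hb(c)] for each letter [c], so [01]
    moves across the word one letter at a time. *)
Lemma fibonacci2_conj w :
  morph fibonacci (morph fibonacci w) ++ [:: false; true] =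
  [:: false; true] ++ morph hb w.
Proof.
elim: w => [|c w IHw] //; rewrite -cat1s !morph_cat -catA IHw.
by case: c.
Qed.

Lemma shift_fib_fixed x :
  is_fixed_point fibonacci x -> is_fixed_point hb (shift_fib x).
Proof.
move=> hx; have [hx1 _] := hx.
have yE n : mkseq (shift_fib x) n.+1 = false :: mkseq x n.
  by rewrite -add1n mkseq_cat.
split=> [[|n]|N] //; last first.
  exists N; rewrite -{1}(size_mkseq (shift_fib x) N) size_morph //.
  by case.
(* The extra letter [x n] is taken because its double image begins with [01], the suffix that the
   conjugation consumes. *)
have [t et] : exists t, mkseq x (size (morph fibonacci (morph fibonacci
    (mkseq x n.+1)))) = [:: false; true] ++ morph hb (mkseq x n) ++ t.
  have -> : mkseq x (size (morph fibonacci (morph fibonacci (mkseq x n.+1)))) =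
     morph fibonacci (morph fibonacci (mkseq x n.+1)).
    by rewrite (hx1 n.+1) -hx1.
  have [t et] : exists t, morph fibonacci (morph fibonacci [:: x n]) =
      [:: false; true] ++ t.
    by case: (x n); [exists [::] | exists [:: false]].
  exists t; rewrite mkseqS -cats1 (morph_cat _ (mkseq x n)).
  by rewrite (morph_cat _ (morph _ _)) et catA fibonacci2_conj -catA.
rewrite yE -cat1s morph_cat.
have := yE (size (morph fibonacci (morph fibonacci (mkseq x n.+1)))).
by rewrite et -cat1s !catA => /mkseq_prefix.
Qed.

Lemma mkseq_comp (A B : Type) (g : A -> B) (f : nat -> A) n :
  mkseq (fun i => g (f i)) n = map g (mkseq f n).
Proof. by rewrite /mkseq -map_comp. Qed.

Lemma h_word_letter_of x x_H :
  is_fixed_point fibonacci x -> x_H 0 = La -> is_fixed_point h x_H ->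
  x_H =1 (fun n => letter_of (shift_fib x n)).
Proof.
move=> hx xH0 hH; apply: (fixed_point_unique _ _ _ hH) => //; first by case.
  by rewrite xH0.
have [hy _] := shift_fib_fixed hx.
have hm w : morph h (map letter_of w) = map letter_of (morph hb w).
  elim: w => // c w IHw; rewrite map_cons -cat1s morph_cat IHw.
  by rewrite -(cat1s c) morph_cat map_cat; case: c.
split=> [n|N] /=.
  by rewrite !mkseq_comp hm {1}hy !size_map.
exists N; rewrite -{1}(size_mkseq (fun n => letter_of (shift_fib x n)) N).
by apply: size_morph; case.
Qed.

(** * Counting ones: adjunction and balance *)

Definition ones (y : nat -> bool) n := count_mem true (mkseq y n).

Lemma onesS y n : ones y n.+1 = ones y n + y n.
Proof. by rewrite /ones mkseqS -cats1 count_cat /= addn0; case: (y n). Qed.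

Lemma onesD y m n :
  ones y (m + n) = ones y m + count_mem true (mkseq (fun j => y (m + j)) n).
Proof. by rewrite /ones mkseq_cat count_cat. Qed.

Lemma leq_ones y m n : m <= n -> ones y m <= ones y n.
Proof. by move=> /subnKC <-; rewrite onesD leq_addr. Qed.

Lemma ones_le y n : ones y n <= n.
Proof. by rewrite -[leqRHS](size_mkseq y) count_size. Qed.

Lemma size_hb w : size (morph hb w) = 3 * size w - count_mem true w.
Proof.
elim: w => // c w IHw; rewrite -cat1s morph_cat !size_cat IHw count_cat.
by have := count_size (pred1 true) w; case: c => /=; lia.
Qed.

Lemma count_hb w : count_mem true (morph hb w) = size w.
Proof.
elim: w => // c w IHw; rewrite -cat1s morph_cat !size_cat count_cat IHw.
by case: c.
Qed.

Lemma last_hb w : 0 < size w -> last false (morph hb w).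
Proof.
case/lastP: w => // w c _.
by rewrite -cats1 morph_cat last_cat; case: c.
Qed.

(* [3 * m - ones y m] is the length of the image of the prefix of length [m],
   and every letter has an image with exactly one [true], at its end. *)
Lemma ones_galois y m n :
  is_fixed_point hb y -> (m <= ones y n) = (3 * m - ones y m <= n).
Proof.
case=> hy _; have := hy m => /=.
have -> : size (morph hb (mkseq y m)) = 3 * m - ones y m.
  by rewrite size_hb size_mkseq.
set t := 3 * m - _ => e.
have et : ones y t = m by rewrite /ones -e count_hb size_mkseq.
apply/idP/idP => [le_m|/(leq_ones y)]; last by rewrite et.
rewrite leqNgt; apply/negP => lt_n; have m_gt0 : 0 < m by lia.
have := last_hb (w := mkseq y m); rewrite e size_mkseq => /(_ m_gt0).
case: t lt_n et {e} => // t; rewrite ltnS => /(leq_ones y) le_t.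
by rewrite onesS mkseqS last_rcons => et y_t; rewrite y_t in et; lia.
Qed.

Lemma ones_subadd y i n :
  is_fixed_point hb y -> y 0 = false -> y 1 = false ->
  ones y i + ones y n <= ones y (i + n) <= ones y i + ones y n + 1.
Proof.
move=> hy y0 y1.
have e2 : ones y 2 = 0 by rewrite /ones /mkseq /= y0 y1.
have e1 : ones y 1 = 0 by rewrite /ones /mkseq /= y0.
(* This makes the induction descend: for positive [i] and [n], [ones y i + 1] and [ones y n + 1] add
   up to less than [i + n], except when [i = n = 1], which is settled directly. *)
have gap k : k <= 1 \/ ones y k + 2 <= k.
  case: k => [|[|k]]; [by left|by left|right].
  elim: k => [|k IHk]; first by rewrite e2.
  by rewrite onesS; case: (y _); lia.
have [N] := ubnP (i + n); elim: N => // N IHN in i n *; rewrite ltnS => le_N.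
have [->|i_gt0] := posnP i; first by rewrite add0n leqnn leq_addr.
have [->|n_gt0] := posnP n; first by rewrite !addn0 leqnn leq_addr.
have [|] := boolP ((i == 1) && (n == 1)).
  by case/andP=> /eqP-> /eqP->; rewrite e1 e2.
move=> ne; have gi := gap i; have gn := gap n.
have lt_i : ones y i < i.
  by case: gi => ?; [have -> : i = 1 by lia | lia]; rewrite e1.
have lt_n : ones y n < n.
  by case: gn => ?; [have -> : n = 1 by lia | lia]; rewrite e1.
have gal := ones_galois _ _ hy; apply/andP; split.
  (* By the adjunction at [p = ones y i] and [q = ones y n], the lower bound reduces to
     [ones y p + ones y q <= ones y (p + q)]. *)
  have /andP[IH _] := IHN (ones y i) (ones y n) ltac:(lia).
  rewrite gal; have := gal (ones y i) i; have := gal (ones y n) n.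
  have := ones_le y (ones y i); have := ones_le y (ones y n).
  by rewrite !leqnn; lia.
have [|ge2] := leqP (i + n) ((ones y i).+1 + (ones y n).+1).
  move=> le2; have [ei en] : i = (ones y i).+1 /\ n = (ones y n).+1 by lia.
  have ei1 : i = 1 by lia.
  have en1 : n = 1 by lia.
  by rewrite ei1 en1 eqxx in ne.
(* By the adjunction, [m = ones y i + 1] satisfies [i < 3 * m - ones y m]; this and its analogue for
   [n] are added. *)
have /andP[_ IH] := IHN (ones y i).+1 (ones y n).+1 ltac:(lia).
rewrite -ltnS ltnNge -addn1 -addnA addnA.
have := gal (ones y i).+1 i; have := gal (ones y n).+1 n.
have := gal ((ones y i).+1 + (ones y n).+1) (i + n).
have := ones_le y (ones y i).+1; have := ones_le y (ones y n).+1.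
rewrite !ltnn; lia.
Qed.

(* Prefixes of the Fibonacci word are left special: [0 p] and [1 p] are mapped
   to [0 1 phi(p)] and [0 phi(p)]. *)
Lemma prefix_left_special x n c :
  is_fixed_point fibonacci x -> is_nonempty_factor x (c :: mkseq x n).
Proof.
move=> hx; have [hx1 _] := hx; have x0 := fibonacci_word0 hx.
have m1 : mkseq x 1 = [:: false] by rewrite /mkseq /= x0.
have m2 : mkseq x 2 = [:: false; true] by have := hx1 1; rewrite m1.
have m3 : mkseq x 3 = [:: false; true; false] by have := hx1 2; rewrite m2.
have m5 : mkseq x 5 = [:: false; true; false; false; true].
  by have := hx1 3; rewrite m3.
suff [i e] : exists i, c :: mkseq x n = mkseq (fun j => x (i + j)) n.+1.
  by split; last exists i; rewrite /= size_mkseq.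
elim: n c => [|n IHn] c.
  case: m5 => e0 e1 *; exists c.
  by rewrite /mkseq /= addn0; case: c; rewrite /= (e0, e1).
(* The empty prefix has an empty image, so length 1 is read off [01001]: [10] occurs at index 1 and
   [00] at index 2. *)
case: n IHn => [|n] IHn.
  case: m5 => e0 e1 e2 e3 e4; exists (if c then 1 else 2).
  by rewrite /mkseq /= x0; case: c; rewrite (e1, e2) (e2, e3).
have [i ei] := IHn (~~ c).
(* One letter is gained because [x 0] is [false], whose image has length 2. *)
have le : n.+2 <= size (morph fibonacci (mkseq x n.+1)).
  rewrite /mkseq /= x0 /morph /= !ltnS.
  by apply: leq_trans (size_morph fibonacci_gt0 _); rewrite size_map size_iota.
have [s es] : exists s, fibonacci (~~ c) = s ++ [:: c].
  by case: c {ei}; [exists [:: false] | exists [::]].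
have := hx1 (i + n.+2); rewrite /= mkseq_cat -ei -cat1s !morph_cat.
rewrite [morph _ [:: _]]cats0 es -(cat_take_drop n.+2 (morph _ (mkseq x n.+1))).
rewrite -(image_take hx le) -!catA catA (catA [:: c]) => e.
have := mkseq_factor (f := x) (i := 0) (esym e).
by rewrite (size_cat [:: c]) size_mkseq; eexists; eassumption.
Qed.

(** * The set S(L_F) and its complement between consecutive levels *)

(** For [y = 0 x_F] this is [X(n)], the value of S on the prefix of length [n] of [y]. *)
Definition level (a b : nat) (y : nat -> bool) (n : nat) : nat :=
  a * (n - ones y n) + b * ones y n.

Lemma levelS a b y n :
  level a b y n.+1 = level a b y n + (if y n then b else a).
Proof.
have := ones_le y n; rewrite /level onesS; case: (y n) => le_n.
  by rewrite addn1 subSS mulnS; lia.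
by rewrite addn0 subSn // mulnS; lia.
Qed.

Lemma S_F_size a b w :
  S_F a b w = a * (size w - count_mem true w) + b * count_mem true w.
Proof.
rewrite /S_F -(count_predC (pred1 true) w) addKn; congr (a * _ + _).
by apply: eq_count; case.
Qed.

Lemma image_SF_level a b x k :
  b <= a -> is_fixed_point fibonacci x ->
  image_SF a b x k <-> exists n, 0 < n /\
    (k = level a b (shift_fib x) n \/ k + (a - b) = level a b (shift_fib x) n).
Proof.
move=> le_ba hx; set y := shift_fib x.
have yE i n : mkseq (fun j => x (i + j)) n = mkseq (fun j => y (i.+1 + j)) n.
  by apply: eq_mkseq.
have ones_x n : count_mem true (mkseq x n) = ones y n.+1.
  by rewrite -add1n onesD.
have lvl n : 0 < n -> ones y n < n.
  by case: n => // n _; rewrite -ones_x ltnS (ones_le x).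
split=> [[w [[w_gt0 [i ew]] <-]]|[n [n_gt0 kE]]].
  exists (size w); split=> //; rewrite S_F_size.
  have /(_ (size w) w_gt0) := lvl; set n := size w => lt_n.
  have cw : ones y (i.+1 + n) = ones y i.+1 + count_mem true w.
    by rewrite onesD -yE -ew.
  have := ones_subadd i.+1 n (shift_fib_fixed hx) erefl (fibonacci_word0 hx).
  rewrite -/y cw -addnA !leq_add2l => /andP[le_c].
  rewrite leq_eqVlt => /orP[/eqP ->|]; last first.
    rewrite addn1 ltnS => ge_c; left; rewrite /level.
    by have -> : ones y n = count_mem true w by apply/eqP; rewrite eqn_leq le_c.
  right; rewrite /level addn1.
  have -> : n - ones y n = (n - (ones y n).+1).+1 by lia.
  by rewrite !mulnS; lia.
case: n => // n in n_gt0 kE; have lt_n := lvl n.+1 isT.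
(* Preceded by [false], the prefix of [x] of length [n] becomes the prefix of [y] of length [n + 1];
   preceded by [true], it has one more 1. *)
have cE c : S_F a b (c :: mkseq x n) =
    a * (n.+1 - (ones y n.+1 + c)) + b * (ones y n.+1 + c).
  by rewrite S_F_size /= size_mkseq ones_x (addnC (_ == _)) eqb_id.
case: kE => kE.
  exists (false :: mkseq x n); split; first exact: prefix_left_special.
  by rewrite cE addn0 kE.
exists (true :: mkseq x n); split; first exact: prefix_left_special.
rewrite cE addn1; move: kE; rewrite /level.
have -> : n.+1 - ones y n.+1 = (n.+1 - (ones y n.+1).+1).+1 by lia.
by rewrite !mulnS; lia.
Qed.

(** Levels grow by at least [b], and [a - b < b]. Hence [X(m) - (a - b)] exceeds [X(n+1)] for
    [m > n + 1], and only [X(n)] and [X(n+1) - (a - b)] can be hit in this range. *)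
Lemma complement_SF_block a b x n j :
  b <= a -> a < 2 * b -> is_fixed_point fibonacci x ->
  let y := shift_fib x in let w := if y n then b else a in
  j < w ->
  complement_SF a b x (level a b y n + j) <-> 0 < j /\ j + (a - b) <> w.
Proof.
move=> le_ba lt_a hx y w lt_j; rewrite /complement_SF image_SF_level // -/y.
have mono m1 m2 : m1 <= m2 -> level a b y m1 + b * (m2 - m1) <= level a b y m2.
  move/subnKC <-; rewrite addKn; elim: (m2 - m1) => [|m IHm].
    by rewrite addn0 muln0 addn0.
  by rewrite addnS levelS mulnS; case: ifP => _; lia.
have lS : level a b y n.+1 = level a b y n + w by rewrite levelS.
have le_w : w <= a by rewrite /w; case: (y n).
clearbody w y.
split=> [[gt0 no]|[j_gt0 ne]].
  split=> [|e]; last by apply: no; exists n.+1; split=> //; right; lia.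
  (* For [j = 0] the point is [X(n)]: it is attained if [n > 0], and it is 0, hence excluded, if
     [n = 0]. *)
  case: j {lt_j} gt0 no => // + no; rewrite addn0 => gt0; case: no; exists n.
  by split; [case: (n) gt0 => //; rewrite /level !muln0 | left; lia].
split=> [|[m [m_gt0 e]]]; first lia.
have [le_mn|lt_nm] := leqP m n.
  by have := leq_trans (leq_addr _ _) (mono m n le_mn); case: e => e; lia.
have h := mono n.+1 m lt_nm; have h0 := leq_trans (leq_addr _ _) h.
case: e => e; first lia.
have [m_eq|m_gt] : m = n.+1 \/ n.+1 < m by lia.
  by rewrite m_eq in e; lia.
have : b * 1 <= b * (m - n.+1) by rewrite leq_mul2l; lia.
by lia.
Qed.

(** * Gap sequences and increasing enumerations *)

(** A finite piece of the difference sequence, described without an enumeration so that pieces can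
    be concatenated. *)
Fixpoint gaps (P : nat -> Prop) (u : nat) (s : seq nat) : Prop :=
  if s is k :: s' then
    [/\ 0 < k, P (u + k), forall j, 0 < j < k -> ~ P (u + j)
      & gaps P (u + k) s']
  else True.

Lemma gaps_cat P u s t :
  gaps P u (s ++ t) <-> gaps P u s /\ gaps P (u + sumn s) t.
Proof.
elim: s u => [|k s IHs] u /=; first by rewrite addn0; split=> [|[]].
split=> [[? ? ? /IHs[]]|[[? ? ? ?]]]; first by rewrite addnA.
by rewrite addnA => ?; split=> //; apply/IHs.
Qed.

Lemma gaps_nseq1 (P : nat -> Prop) u n :
  (forall j, 0 < j <= n -> P (u + j)) -> gaps P u (nseq n 1).
Proof.
elim: n u => //= n IHn u Pu; split=> //; first by apply: Pu.
  by case=> [|[]].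
by apply: IHn => j le_j; rewrite -addnA add1n; apply: Pu; lia.
Qed.

Lemma difference_gaps P C n u s :
  is_increasing_enumeration P C -> C n = u -> gaps P u s ->
  mkseq (fun j => difference C (n + j)) (size s) = s /\
  C (n + size s) = u + sumn s.
Proof.
case=> C_lt C_P; have C_mono : {mono C : i j / i <= j}.
  by apply: leq_mono; apply: homo_ltn C_lt; apply: ltn_trans.
elim: s n u => [|k s IHs] n u /= Cn; first by rewrite !addn0.
case=> k_gt0 Pk noP gs.
have CS : C n.+1 = u + k.
  have /C_P[m Cm] := Pk; have lt_nm : n < m.
    by rewrite ltnNge -C_mono Cm Cn; lia.
  apply/eqP; rewrite eqn_leq -Cm C_mono lt_nm Cm /= leqNgt; apply/negP => lt_C.
  have := C_lt n; rewrite Cn => lt_u; apply: (noP (C n.+1 - u)); first lia.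
  by rewrite subnKC 1?ltnW //; apply/C_P; exists n.+1.
have [e1 e2] := IHs _ _ CS gs; split; last by rewrite addnS -addSn e2 addnA.
rewrite -add1n mkseq_cat -[RHS]cat1s; congr (_ ++ _).
  by rewrite /mkseq /= addn0 /difference CS Cn addKn.
by rewrite -{2}e1; apply: eq_mkseq => j; rewrite addnA addn1.
Qed.

(** Greedy choice: each term is the least element of [P] above the previous one. *)
Lemma enumeration_exists (P : pred nat) :
  (forall n, exists k, (n <= k) && P k) ->
  exists C, is_increasing_enumeration P C.
Proof.
move=> infP; pose next n := ex_minn (infP n).
pose fix C n := next (if n is m.+1 then (C m).+1 else 0).
have CP n : P (C n).
  by case: n => [|n] /=; rewrite /next; case: ex_minnP => k /andP[].
have C_lt n : C n < C n.+1.
  by rewrite [C n.+1]/= /next; case: ex_minnP => k /andP[].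
have C_ge n : n <= C n by elim: n => // n IHn; apply: leq_trans (C_lt n).
exists C; split=> // k; split=> [Pk|[n <-]] //.
have [n lt_k] : exists n, k < C n by exists k.+1; apply: C_ge.
elim: n lt_k => [|n IHn].
  rewrite /= /next; case: ex_minnP => m _ /(_ k); rewrite Pk => /(_ isT).
  by rewrite leqNgt => /negP.
rewrite /= /next; case: ex_minnP => m _ /(_ k); rewrite Pk andbT => le_m lt_k.
have [/le_m|/IHn //|<-] := ltngtP (C n) k; last by exists n.
by rewrite leqNgt lt_k.
Qed.

Lemma enumeration_head P C :
  is_increasing_enumeration P C -> ~ P 0 -> P 1 -> C 0 = 1.
Proof.
case=> C_lt C_P P0 /C_P[n Cn].
have C_mono : {homo C : i j / i <= j}.
  by apply: homo_leq => //; [exact: leq_trans | move=> i; apply: ltnW].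
have := C_mono 0 n (leq0n n); rewrite Cn.
by case e: (C 0) => [|[|]] //; case: P0; apply/C_P; exists 0.
Qed.

(** * Blocks of the complement and the images under [delta] *)

(** Each of the missing offsets [w - d] and [w] merges two unit gaps into a 2. The block runs from
    offset 1 to offset [w + 1], where the next one starts. *)
Lemma gaps_block (P : nat -> Prop) u w d :
  1 < d -> d + 1 < w ->
  (forall j, 0 < j <= w.+1 -> P (u + j) <-> j + d <> w /\ j <> w) ->
  gaps P (u + 1) (nseq (w - d - 2) 1 ++ [:: 2] ++ nseq (d - 2) 1 ++ [:: 2]).
Proof.
move=> d_gt1 lt_w PE; apply/gaps_cat; split.
  by apply: gaps_nseq1 => j le_j; rewrite -addnA; apply/PE; lia.
rewrite sumn_nseq mul1n /=; split=> //.
- by rewrite -!addnA; apply/PE; lia.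
- by case=> [|[|]] // _; rewrite -!addnA => /PE; lia.
apply/gaps_cat; split.
  by apply: gaps_nseq1 => j le_j; rewrite -!addnA; apply/PE; lia.
rewrite sumn_nseq mul1n; split=> //.
- by rewrite -!addnA; apply/PE; lia.
by case=> [|[|]] // _; rewrite -!addnA => /PE; lia.
Qed.

Lemma gaps_delta a b x n :
  a + 2 < 2 * b + 1 -> 2 * b + 1 < 2 * a - 1 -> is_fixed_point fibonacci x ->
  let y := shift_fib x in
  gaps (complement_SF a b x) (level a b y n + 1) (delta a b (letter_of (y n))).
Proof.
move=> hab1 hab2 hx y.
have le_ba : b <= a by lia.
have lt_a : a < 2 * b by lia.
have block := complement_SF_block (n := _) (j := _) le_ba lt_a hx.
pose w := if y n then b else a.
have -> : delta a b (letter_of (y n)) =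
    nseq (w - (a - b) - 2) 1 ++ [:: 2] ++ nseq (a - b - 2) 1 ++ [:: 2].
  by rewrite /w; case: (y n) => /=; congr (nseq _ _ ++ _); lia.
have lt_w m : a - b + 1 < if y m then b else a by case: (y m); lia.
apply: gaps_block; [lia | exact: lt_w | move=> j /andP[j_gt0 le_j]].
have [lt_j|ge_j] := ltnP j w; first by rewrite block // -/y -/w; lia.
(* Here [j] is [w] or [w + 1], that is, offset 0 or 1 of the next block. *)
have lvl : level a b y n + j = level a b y n.+1 + (j - w).
  by rewrite levelS -/w -addnA subnKC.
by rewrite lvl block -/y; have := lt_w n.+1; have := lt_w n; rewrite -/w; lia.
Qed.

Lemma sumn_delta a b c :
  a + 2 < 2 * b + 1 -> 2 * b + 1 < 2 * a - 1 ->
  sumn (delta a b (letter_of c)) = if c then b else a.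
Proof.
move=> hab1 hab2; rewrite /delta.
by case: c; rewrite /= !sumn_cat !sumn_nseq /= sumn_cat sumn_nseq /=; lia.
Qed.

Lemma leq_level a b y n : 0 < a -> 0 < b -> n <= level a b y n.
Proof.
move=> a_gt0 b_gt0; elim: n => // n IHn; rewrite levelS.
by case: (y n); lia.
Qed.

Lemma eq_enumeration (P Q : nat -> Prop) C :
  (forall k, P k <-> Q k) -> is_increasing_enumeration P C ->
  is_increasing_enumeration Q C.
Proof.
by move=> PQ [C_lt C_P]; split=> // k; apply: iff_trans (C_P k); apply: iff_sym.
Qed.

Theorem theorem4 (a b : nat) (x_F : nat -> bool) (x_H : nat -> letter)
    (a_gt0 : 0 < a) (b_gt0 : 0 < b)
    (hab1 : a + 2 < 2 * b + 1) (hab2 : 2 * b + 1 < 2 * a - 1)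
    (hx_F : is_fixed_point fibonacci x_F)
    (hx_H0 : x_H 0 = La) (hx_H : is_fixed_point h x_H) :
  (exists C, is_increasing_enumeration (complement_SF a b x_F) C) /\
  (forall C, is_increasing_enumeration (complement_SF a b x_F) C ->
     is_image (delta a b) x_H (difference C)).
Proof.
have xHE := h_word_letter_of hx_F hx_H0 hx_H.
have le_ba : b <= a by lia.
set y := shift_fib x_F in xHE.
(* These points show that the complement is infinite and that it starts at 1. *)
have Pbelow n : complement_SF a b x_F (level a b y n + 1).
  by apply/complement_SF_block => //; rewrite -/y; case: (y n); lia.
split=> [|C hC].
  (* A boolean form of the complement: since [n <= X(n)], only indices up to [k + (a - b)] can
     witness that [k] is attained. *)
  pose P k := (0 < k) && ~~ has (fun n => (k == level a b y n) ||
    (k + (a - b) == level a b y n)) (iota 1 (k + (a - b))).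
  have PE k : P k <-> complement_SF a b x_F k.
    rewrite /complement_SF image_SF_level // -/y.
    split=> [/andP[k_gt0 /hasP no]|[k_gt0 no]].
      split=> // -[n [n_gt0 e]]; apply: no; exists n.
        by rewrite mem_iota; have := leq_level y n a_gt0 b_gt0; lia.
      by case: e => ->; rewrite eqxx ?orbT.
    rewrite /P k_gt0; apply/hasP => -[n]; rewrite mem_iota => /andP[n_gt0 _] e.
    by apply: no; exists n; split=> //; case/orP: e => /eqP; [left | right].
  have [|C hC] := enumeration_exists (P := P); last first.
    by exists C; apply: eq_enumeration hC.
  move=> n; exists (level a b y n + 1); apply/andP; split; last exact/PE.
  by have := leq_level y n a_gt0 b_gt0; lia.
have C0 : C 0 = 1.
  apply: enumeration_head hC _ _ => [[]|] //.
  by have := Pbelow 0; rewrite /level !muln0.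
(* The sum is carried along because it places the start of the next block at [X(n) + 1]. *)
have blocks n : gaps (complement_SF a b x_F) 1 (morph (delta a b) (mkseq x_H n))
    /\ sumn (morph (delta a b) (mkseq x_H n)) = level a b y n.
  elim: n => [|n [IHg IHs]]; first by rewrite /level !muln0.
  rewrite mkseqS -cats1 morph_cat sumn_cat IHs [morph _ [:: _]]cats0 xHE.
  rewrite sumn_delta // levelS; split=> //; apply/gaps_cat; split=> //.
  by rewrite IHs addnC; apply: gaps_delta.
split=> [n v|N].
  by have [e _] := difference_gaps hC C0 (proj1 (blocks n)); rewrite -[LHS]e.
exists N; rewrite -{1}(size_mkseq x_H N); apply: size_morph.
by case=> /=; rewrite size_cat addnC.
Qed.
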